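(* For every term $\mathfrak{t}$ over the alphabet $\{\mathsf{M}\}$ (possibly containing variables), the poset $\mathcal{P}(\mathfrak{t}) = \{\mathfrak{t}' : \mathfrak{t} \preccurlyeq \mathfrak{t}'\}$, ordered by $\preccurlyeq$, is a finite lattice.
   Context: Terms over $\{\mathsf{M}\}$: every variable $\mathsf{x}_i$ ($i \geq 1$) is a term, the constant $\mathsf{M}$ is a term, and if $\mathfrak{t}_1,\mathfrak{t}_2$ are terms then so is their application $\mathfrak{t}_1\mathfrak{t}_2$ (a binary tree with root having left subtree $\mathfrak{t}_1$ and right subtree $\mathfrak{t}_2$; juxtaposition associates to the left). The one-step rewrite relation $\Rightarrow$ is defined by: $\mathfrak{t} \Rightarrow \mathfrak{t}'$ iff $\mathfrak{t}'$ is obtained from $\mathfrak{t}$ by replacing one subterm of the form $\mathsf{M}\mathfrak{s}$ (for some term $\mathfrak{s}$) by $\mathfrak{s}\mathfrak{s}$ (this is the context closure of the rule $\mathsf{M}\mathsf{x}_1 \to \mathsf{x}_1\mathsf{x}_1$). The relation $\preccurlyeq$ is the reflexive and transitive closure of $\Rightarrow$; it is a partial order on the set of all terms. *)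

(* Defs.v *)
From HB Require Import structures.
From mathcomp Require Import all_boot all_order.
From Stdlib Require Import Relation_Operators.

Set Implicit Arguments.
Unset Strict Implicit.
Unset Printing Implicit Defensive.

Local Open Scope order_scope.

(* [Var i] is the variable x_(i+1), so that indices range over all i >= 1. *)
Inductive term : Type :=
  | Var of nat
  | M
  | App of term & term.

Inductive step : term -> term -> Prop :=
  | step_M s : step (App M s) (App s s)
  | step_l t1 t1' t2 : step t1 t1' -> step (App t1 t2) (App t1' t2)
  | step_r t1 t2 t2' : step t2 t2' -> step (App t1 t2) (App t1 t2').

Definition reduces : term -> term -> Prop := clos_refl_trans term step.

Definition upset (t : term) : term -> Prop := fun t' => reduces t t'.

(* The order on [A] is a [Prop]-valued relation on the ambient type, so the
   lattice structure is carried by a finite lattice [L] that [f] identifies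
   with ([A], [le]): [f] is a bijection from [L] onto [A] that preserves and
   reflects the order. In particular [le] is a partial order on [A]. *)
Definition finite_lattice (T : Type) (A : T -> Prop) (le : T -> T -> Prop) :
    Prop :=
  exists (d : Order.disp_t) (L : finLatticeType d) (f : L -> T),
    [/\ injective f,
        forall y : T, A y <-> exists x : L, f x = y
      & forall x y : L, x <= y <-> le (f x) (f y)].

(* Main.v *)
Require Import Defs.
From HB Require Import structures.
From mathcomp Require Import all_boot all_order.
From Stdlib Require Import Relation_Operators Operators_Properties.

Set Implicit Arguments.
Unset Strict Implicit.
Unset Printing Implicit Defensive.

Import Order.TTheory.

Local Open Scope order_scope.

(** If [t1] differs from [M], no reduction ever contracts the root of
    [App t1 t2], so the poset of [App t1 t2] is the product of those of [t1]
    and [t2]. Let [L] be the poset of [s]. A reduction from [App M s] first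
    reduces [s] to some [s'], then possibly duplicates [s'] and reduces both
    copies independently; hence for [s] other than [M] the poset of [App M s]
    is the disjoint union of [L] and [L * L], where [a] in [L] is below [(b, c)]
    iff [a] is below both [b] and [c]. These constructions preserve finite
    lattices, and the theorem follows by induction on the term. *)

Definition dup_sum (L : Type) : Type := (L + L * L)%type.

HB.instance Definition _ (L : finType) := Finite.on (dup_sum L).

Definition dup_le d (L : porderType d) (x y : dup_sum L) : bool :=
  match x, y with
  | inl a, inl b => a <= b
  | inl a, inr (b1, b2) => (a <= b1) && (a <= b2)
  | inr (a1, a2), inr (b1, b2) => (a1 <= b1) && (a2 <= b2)
  | inr _, inl _ => false
  end.

(** Only [inl] elements lie below an [inl], and [inl x] is below [inr (b1, b2)] iff [x] is below the
    meet of [b1] and [b2]; this forces the mixed cases. *)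
Definition dup_meet d (L : latticeType d) (x y : dup_sum L) : dup_sum L :=
  match x, y with
  | inl a, inl b => inl (a `&` b)
  | inl a, inr (b1, b2) => inl (a `&` (b1 `&` b2))
  | inr (a1, a2), inl b => inl ((a1 `&` a2) `&` b)
  | inr (a1, a2), inr (b1, b2) => inr (a1 `&` b1, a2 `&` b2)
  end.

(** Only [inr] elements lie above an [inr], and among them [inl a] has the same upper bounds as
    [inr (a, a)]. So a mixed join treats [a] as the pair [(a, a)]. *)
Definition dup_join d (L : latticeType d) (x y : dup_sum L) : dup_sum L :=
  match x, y with
  | inl a, inl b => inl (a `|` b)
  | inl a, inr (b1, b2) => inr (a `|` b1, a `|` b2)
  | inr (a1, a2), inl b => inr (a1 `|` b, a2 `|` b)
  | inr (a1, a2), inr (b1, b2) => inr (a1 `|` b1, a2 `|` b2)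
  end.

Lemma dup_le_refl d (L : porderType d) : reflexive (@dup_le d L).
Proof. by case=> [a|[a b]] /=; rewrite !lexx. Qed.

Lemma dup_le_anti d (L : porderType d) : antisymmetric (@dup_le d L).
Proof.
case=> [a|[a1 a2]] [b|[b1 b2]] //=.
- by move/le_anti->.
- by rewrite andbF.
- by rewrite andbACA => /andP[/le_anti-> /le_anti->].
Qed.

Lemma dup_le_trans d (L : porderType d) : transitive (@dup_le d L).
Proof.
case=> [b|[b1 b2]] [a|[a1 a2]] [c|[c1 c2]] //=.
- exact: le_trans.
- by move=> ab /andP[bc1 bc2]; rewrite !(le_trans ab).
- by move=> /andP[h1 h2] /andP[k1 k2]; rewrite (le_trans h1) // (le_trans h2).
- by move=> /andP[h1 h2] /andP[k1 k2]; rewrite (le_trans h1) // (le_trans h2).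
Qed.

HB.instance Definition _ d (L : finLatticeType d) :=
  Order.Le_isPOrder.Build d (dup_sum L)
    (@dup_le_refl d L) (@dup_le_anti d L) (@dup_le_trans d L).

Lemma dup_lexI d (L : finLatticeType d) (x y z : dup_sum L) :
  (x <= dup_meet y z) = (x <= y) && (x <= z).
Proof.
rewrite /Order.le /=.
(* After [lexI] both sides are conjunctions of the same comparisons in [L], so a case split on their
   truth values concludes. *)
by case: x y z => [a|[a1 a2]] [b|[b1 b2]] [c|[c1 c2]] //=;
  rewrite ?lexI ?andbF //; do ?case: (_ <= _).
Qed.

Lemma dup_leUx d (L : finLatticeType d) (x y z : dup_sum L) :
  (dup_join x y <= z) = (x <= z) && (y <= z).
Proof.
rewrite /Order.le /=.
by case: x y z => [a|[a1 a2]] [b|[b1 b2]] [c|[c1 c2]] //=;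
  rewrite ?leUx ?andbF //; do ?case: (_ <= _).
Qed.

HB.instance Definition _ d (L : finLatticeType d) :=
  Order.POrder_MeetJoin_isLattice.Build d (dup_sum L)
    (@dup_lexI d L) (@dup_leUx d L).

Lemma reduces_refl t : reduces t t.
Proof. exact: rt_refl. Qed.

Lemma reduces_trans t u v : reduces t u -> reduces u v -> reduces t v.
Proof. exact: rt_trans. Qed.

Lemma reduces_App t1 t2 u1 u2 :
  reduces t1 u1 -> reduces t2 u2 -> reduces (App t1 t2) (App u1 u2).
Proof.
move=> r1 r2; apply: (@reduces_trans _ (App u1 t2)).
  elim: r1 => [? ? ?|?|? ? ? _ + _]; last exact: reduces_trans.
    by apply/rt_step/step_l.
  exact: reduces_refl.
elim: r2 => [? ? ?|?|? ? ? _ + _]; last exact: reduces_trans.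
  by apply/rt_step/step_r.
exact: reduces_refl.
Qed.

Lemma reduces_dup s u1 u2 :
  reduces s u1 -> reduces s u2 -> reduces (App M s) (App u1 u2).
Proof.
move=> r1 r2; apply: (@reduces_trans _ (App s s)); last exact: reduces_App.
exact/rt_step/step_M.
Qed.

(** Invariant principle behind the inversion lemmas below, where [P] describes the possible shapes
    of the reducts of [t]. *)
Lemma reduces_closed (P : term -> Prop) t u :
  (forall v w, P v -> step v w -> P w) -> P t -> reduces t u -> P u.
Proof.
move=> closedP + r; elim: r => [v w st Pv|//|v w x _ vw _ wx /vw/wx //].
exact: closedP st.
Qed.

(** Every step produces an application, so no last step can end in [M]. Hence being different from
    [M] is preserved by reduction. *)
Lemma reduces_to_M t : reduces t M -> t = M.
Proof.
by move=> /clos_rt_rtn1_iff r; inversion r as [|? ? st] => //; inversion st.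
Qed.

Lemma reduces_Var i u : reduces (Var i) u -> u = Var i.
Proof.
by apply: (@reduces_closed (fun v => v = Var i)) => // v w -> st; inversion st.
Qed.

Lemma reduces_M u : reduces M u -> u = M.
Proof.
by apply: (@reduces_closed (fun v => v = M)) => // v w -> st; inversion st.
Qed.

Lemma reduces_App_inv t1 t2 u : t1 <> M -> reduces (App t1 t2) u ->
  exists u1 u2, [/\ u = App u1 u2, reduces t1 u1 & reduces t2 u2].
Proof.
pose P v := exists v1 v2, [/\ v = App v1 v2, reduces t1 v1 & reduces t2 v2].
move=> t1M; apply: (@reduces_closed P) => [v w [u1 [u2 [-> r1 r2]]] st|]; last first.
  by exists t1, t2; split=> //; apply: reduces_refl.
inversion st as [s e1 e2|? v1 ? st1|? ? v2 st2]; subst.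
(* Contracting the root requires [u1 = M], a reduct of [t1]. *)
- by case: t1M; apply: reduces_to_M.
- by exists v1, u2; split=> //; apply: reduces_trans r1 (rt_step _ _ _ _ st1).
- by exists u1, v2; split=> //; apply: reduces_trans r2 (rt_step _ _ _ _ st2).
Qed.

Lemma reduces_AppM_inv s u : reduces (App M s) u ->
  (exists2 v, u = App M v & reduces s v) \/
  exists u1 u2, [/\ u = App u1 u2, reduces s u1 & reduces s u2].
Proof.
pose P v := (exists2 v', v = App M v' & reduces s v') \/
  exists v1 v2, [/\ v = App v1 v2, reduces s v1 & reduces s v2].
apply: (@reduces_closed P) => [v w []|]; last first.
- by left; exists s => //; apply: reduces_refl.
- case=> [u1 [u2 [-> r1 r2]]] st.
  inversion st as [? e1 e2|? v1 ? st1|? ? v2 st2]; subst; right.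
  (* Here [u1 = M], which happens only for [s = M]; the contractum [App u2 u2] keeps the second
     form. *)
  + by exists u2, u2.
  + by exists v1, u2; split=> //; apply: reduces_trans r1 (rt_step _ _ _ _ st1).
  + by exists u1, v2; split=> //; apply: reduces_trans r2 (rt_step _ _ _ _ st2).
- case=> v' -> r st.
  inversion st as [? e1 e2|? v1 ? st1|? ? v2 st2]; subst.
  + by right; exists v', v'.
  + by inversion st1.
  + by left; exists v2 => //; apply: reduces_trans r (rt_step _ _ _ _ st2).
Qed.

Lemma finite_lattice_normal t :
  (forall u, reduces t u -> u = t) -> finite_lattice (upset t) reduces.
Proof.
move=> normal_t; exists _, 'I_1, (fun=> t); split=> [x y _|u|x y].
- by rewrite [x]ord1 [y]ord1.
- split=> [/normal_t->|[_ <-]]; first by exists ord0.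
  exact: reduces_refl.
- by rewrite [x]ord1 [y]ord1; split=> // _; apply: reduces_refl.
Qed.

Lemma finite_lattice_App t1 t2 : t1 <> M ->
  finite_lattice (upset t1) reduces -> finite_lattice (upset t2) reduces ->
  finite_lattice (upset (App t1 t2)) reduces.
Proof.
move=> t1M [d1 [L1 [f1 [inj1 im1 le1]]]] [d2 [L2 [f2 [inj2 im2 le2]]]].
have r1 x : reduces t1 (f1 x) by apply/im1; exists x.
have r2 x : reduces t2 (f2 x) by apply/im2; exists x.
(* This lets the inversion lemma apply again from every reduct, not only from [App t1 t2]. *)
have f1M x : f1 x <> M by move=> e; apply/t1M/reduces_to_M; rewrite -e.
exists _, (L1 *p L2)%type, (fun x => App (f1 x.1) (f2 x.2)); split.
- by move=> [x1 x2] [y1 y2] /= [/inj1-> /inj2->].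
- move=> u; split=> [/(reduces_App_inv t1M)|[x <-]]; last exact: reduces_App.
  by case=> _ [_ [-> /im1[x1 <-] /im2[x2 <-]]]; exists (x1, x2).
- move=> [x1 x2] [y1 y2]; rewrite leEprod /=; split.
    by case/andP=> /le1 ? /le2 ?; apply: reduces_App.
  case/(reduces_App_inv (f1M _)) => _ [_ [[<- <-] ? ?]].
  by apply/andP; split; [apply/le1 | apply/le2].
Qed.

(** Since no reduct of [s] is [M], a duplicated term [App (f a) (f b)] never has the form [App M _].
    This makes [g] injective and keeps every [inr] from lying below an [inl]. *)
Lemma finite_lattice_AppM s : s <> M ->
  finite_lattice (upset s) reduces ->
  finite_lattice (upset (App M s)) reduces.
Proof.
move=> sM [d [L [f [injf imf lef]]]].
have rf x : reduces s (f x) by apply/imf; exists x.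
have fM x : f x <> M by move=> e; apply/sM/reduces_to_M; rewrite -e.
pose g (x : dup_sum L) :=
  match x with inl a => App M (f a) | inr (a, b) => App (f a) (f b) end.
exists d, (dup_sum L), g; split.
- move=> [a|[a1 a2]] [b|[b1 b2]] //= [].
  + by move=> /injf->.
  + by move=> /esym/fM.
  + by move=> /fM.
  + by move=> /injf-> /injf->.
- move=> u; split=> [/reduces_AppM_inv[[_ -> /imf[a <-]]|]|].
  + by exists (inl a).
  + by case=> _ [_ [-> /imf[a <-] /imf[b <-]]]; exists (inr (a, b)).
  + case=> [[a|[a b]] <-] /=; last exact: reduces_dup.
    by apply: reduces_App => //; apply: reduces_refl.
- move=> [a|[a1 a2]] [b|[b1 b2]]; rewrite /Order.le /=; split=> //.
  + by move/lef; apply: reduces_App; apply: reduces_refl.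
  + case/reduces_AppM_inv=> [[_ [<-] /lef//]|].
    by case=> _ [_ [[<- <-] /reduces_to_M/fM]].
  + by case/andP=> /lef ? /lef ?; apply: reduces_dup.
  + case/reduces_AppM_inv=> [[_ [/fM//]]|].
    by case=> _ [_ [[<- <-] /lef-> /lef->]].
  + by case/(reduces_App_inv (fM _)) => _ [_ [[<- <-] /reduces_to_M/fM]].
  + by case/andP=> /lef ? /lef ?; apply: reduces_App.
  + by case/(reduces_App_inv (fM _)) => _ [_ [[<- <-] /lef-> /lef->]].
Qed.

(** The case [s = M] stands apart: [App M M] contracts to itself, so the two points of [dup_sum]
    over a singleton would collapse to one term. *)
Lemma reduces_MM u : reduces (App M M) u -> u = App M M.
Proof.
case/reduces_AppM_inv=> [[_ -> /reduces_M->] //|].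
by case=> _ [_ [-> /reduces_M-> /reduces_M->]].
Qed.

Theorem theorem2p3p4 (t : term) : finite_lattice (upset t) reduces.
Proof.
elim: t => [i||t1 IH1 t2 IH2].
- exact/finite_lattice_normal/reduces_Var.
- exact/finite_lattice_normal/reduces_M.
(* The condition of being different from [M] holds by distinct constructors, so only [t1 = M]
   remains here, and only [t2 = M] after the next split. *)
case: t1 IH1 => [i||t11 t12] IH1; try exact: finite_lattice_App.
case: t2 IH2 => [i||t21 t22] IH2; try exact: finite_lattice_AppM.
exact/finite_lattice_normal/reduces_MM.
Qed.
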